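(* Let $\mathcal{R} = ((M, G, \triangleright), (m_0, \{g_{m_0,m}\}_{m \in M}))$ be a finitely right generated cell space such that the stabiliser $G_0$ of $m_0$ under $\triangleright$ is finite, and let $S$ be a finite and symmetric right generating set of $\mathcal{R}$. The following statements are equivalent: (1) The cell space $\mathcal{R}$ is right amenable; (2) For each positive real number $\varepsilon$, there is a non-empty and finite subset $F$ of $M$ such that for each $s \in S$, $$\frac{|F \setminus (\_ \trianglelefteq s)^{-1}(F)|}{|F|} < \varepsilon;$$ (3) The $S$-isoperimetric constant $\iota_S(\mathcal{R})$ is $0$.
   Context: A \emph{left homogeneous space} is a triple $(M, G, \triangleright)$ where $M$ is a non-empty set, $G$ is a group, and $\triangleright : G \times M \to M$ is a transitive left group action. A \emph{coordinate system} for it is a tuple $(m_0, \{g_{m_0,m}\}_{m\in M})$ with $m_0 \in M$, $g_{m_0,m} \in G$ and $g_{m_0,m} \triangleright m_0 = m$ for each $m \in M$. A left homogeneous space together with a coordinate system is a \emph{cell space}. $G_0$ is the stabiliser of $m_0$, and $G/G_0$ is the set of left cosets $gG_0$, on which $G$ (hence $G_0$) acts by left multiplication, $g \cdot g'G_0 = gg'G_0$. The cell space induces the map $\trianglelefteq : M \times G/G_0 \to M$, $m \trianglelefteq gG_0 = g_{m_0,m}\, g\, g_{m_0,m}^{-1} \triangleright m = g_{m_0,m}\, g \triangleright m_0$. For $\mathfrak{g} \in G/G_0$, $\_ \trianglelefteq \mathfrak{g}$ denotes the map $M \to M$, $m \mapsto m \trianglelefteq \mathfrak{g}$, and $(\_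 \trianglelefteq \mathfrak{g})^{-1}(F)$ the preimage of $F$ under it. \textbf{Right generating sets.} Let $S \subseteq G/G_0$ with $G_0 \cdot S \subseteq S$. Put $S^{-1} = \{g^{-1}G_0 : s \in S, g \in s\}$. $S$ is a \emph{right generating set} of $\mathcal{R}$ if for each $m \in M$ there are $k \in \mathbb{N}_0$ and $s_1, \dots, s_k \in S \cup S^{-1}$ with $(((m_0 \trianglelefteq s_1) \trianglelefteq s_2) \trianglelefteq \cdots) \trianglelefteq s_k = m$. It is \emph{symmetric} if $S^{-1} \subseteq S$. $\mathcal{R}$ is \emph{finitely right generated} if it has a finite right generating set. \textbf{Isoperimetric constant.} For $E \subseteq G/G_0$, the $E$-isoperimetric constant of $\mathcal{R}$ is $$\iota_E(\mathcal{R}) = \inf_{F} \frac{\left|\bigcup_{e \in E} F \setminus (\_ \trianglelefteq e)^{-1}(F)\right|}{|F|},$$ where $F$ ranges over the non-empty finite subsets of $M$. \textbf{Right amenability.} $\mathcal{R}$ is \emph{right amenable} if there is a finitely additive probability measure $\mu$ on the power set of $M$ such that for each $\mathfrak{g} \in G/G_0$ and each $A \subseteq M$ such that the restriction of $\_ \trianglelefteq \mathfrak{g}$ to $A$ is injective, we have $\mu(A \trianglelefteq \mathfrak{g}) = \mu(A)$, where $A \trianglelefteq \mathfrak{g} = \{a \trianglelefteq \mathfrak{g} : a \in A\}$. *)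

(* Defs.v *)
From mathcomp Require Import all_boot all_order all_algebra.
From mathcomp Require Import finmap.
From mathcomp Require Import all_classical all_reals.

Set Implicit Arguments.
Unset Strict Implicit.
Unset Printing Implicit Defensive.

Import Order.TTheory GRing.Theory Num.Theory.
Local Open Scope classical_set_scope.
Local Open Scope ring_scope.

(* Groups are arbitrary (possibly infinite) [groupType]s.  The [choiceType]
   structure required of [G] and [M] is classically available on every type. *)
Record leftHomogeneousSpace (G : groupType) (M : choiceType) := {
  lact :> G -> M -> M;
  lact1 : forall m, lact 1%g m = m;
  lactM : forall g h m, lact (g * h)%g m = lact g (lact h m);
  lact_trans : forall m m', exists g, lact g m = m';
  lact_nonempty : [set: M] !=set0
}.

Record coordinateSystem (G : groupType) (M : choiceType)
    (H : leftHomogeneousSpace G M) := {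
  origin : M;
  coord : M -> G;
  coordK : forall m, H (coord m) origin = m
}.

Record cellSpace (G : groupType) (M : choiceType) := {
  space : leftHomogeneousSpace G M;
  coordinates : coordinateSystem space
}.

Section CellSpace.
Variables (G : groupType) (M : choiceType) (C : cellSpace G M).

Definition cact : G -> M -> M := space C.
Definition m0 : M := origin (coordinates C).
Definition cg : M -> G := coord (coordinates C).

Definition stab : set G := [set g | cact g m0 = m0].

Definition ltrans (g : G) (A : set G) : set G := [set (g * h)%g | h in A].

(* The quotient G/G_0 as a set of subsets of G. *)
Definition lcosets : set (set G) := [set ltrans g stab | g in [set: G]].

(* [xget 1%g c] is some element of [c]; on cosets the result does not depend on
   which one, see [semiactE]. *)
Definition semiact (m : M) (c : set G) : M := cact (cg m * xget 1%g c)%g m0.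

Lemma semiactE m g : semiact m (ltrans g stab) = cact (cg m * g)%g m0.
Proof.
rewrite /semiact; have : ltrans g stab (xget 1%g (ltrans g stab)).
  by apply: (@xgetPex _ 1%g (ltrans g stab)); exists (g * 1)%g, 1%g => //;
     exact: lact1.
by case=> h sh <-; rewrite mulgA /cact [LHS]lactM; exact: (congr1 (space C _) sh).
Qed.

Lemma semiactEconj m g :
  semiact m (ltrans g stab) = cact (cg m * g * (cg m)^-1)%g m.
Proof.
have cgK : cact (cg m) m0 = m by exact: coordK.
by rewrite semiactE -{4}cgK /cact -lactM mulgVK.
Qed.

Definition cosets_inv (S : set (set G)) : set (set G) :=
  [set c | exists s g, [/\ S s, s g & c = ltrans g^-1%g stab]].

Definition right_generating (S : set (set G)) : Prop :=
  [/\ S `<=` lcosets,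
      forall g s, stab g -> S s -> S (ltrans g s) &
      forall m, exists w : seq (set G),
        (forall s, s \in w -> (S `|` cosets_inv S) s) /\ foldl semiact m0 w = m].

Definition symmetric_cosets (S : set (set G)) : Prop := cosets_inv S `<=` S.

Definition finitely_right_generated : Prop :=
  exists S : set (set G), finite_set S /\ right_generating S.

Variable R : realType.

(* The number of elements of [A]; only used on finite sets. *)
Definition cardR (A : set M) : R := (#|` fset_set A|)%:R.

Definition isoperimetric_constant (E : set (set G)) : R :=
  inf [set cardR (\bigcup_(e in E) (F `\` (semiact^~ e) @^-1` F)) / cardR F
      | F in [set F : set M | finite_set F /\ F !=set0]].

(* The infimum is genuine: [inf] is not applied to a set without infimum, where
   it would be 0 by convention. *)
Lemma has_inf_isoperimetric (E : set (set G)) :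
  has_inf [set cardR (\bigcup_(e in E) (F `\` (semiact^~ e) @^-1` F)) / cardR F
          | F in [set F : set M | finite_set F /\ F !=set0]].
Proof.
split; last by exists 0 => _ [F _ <-]; rewrite divr_ge0 ?ler0n.
by apply: image_nonempty; exists [set m0]; split; [exact: finite_set1|exists m0].
Qed.

Definition finitely_additive_probability (mu : set M -> R) : Prop :=
  [/\ forall A, 0 <= mu A,
      mu [set: M] = 1 &
      forall A B, A `&` B = set0 -> mu (A `|` B) = mu A + mu B].

Definition right_amenable : Prop :=
  exists mu : set M -> R, finitely_additive_probability mu /\
    forall (c : set G) (A : set M), lcosets c -> set_inj A (semiact^~ c) ->
      mu ((semiact^~ c) @` A) = mu A.

End CellSpace.

(* Main.v *)
Require Import Defs.
From mathcomp Require Import all_boot all_order all_algebra.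
From mathcomp Require Import finmap.
From mathcomp Require Import all_classical all_reals.
From mathcomp Require Import topology normedtype sequences.
From mathcomp Require Import lra.

Set Implicit Arguments.
Unset Strict Implicit.
Unset Printing Implicit Defensive.

Import Order.TTheory GRing.Theory Num.Theory.
Import numFieldNormedType.Exports.
Local Open Scope classical_set_scope.
Local Open Scope ring_scope.

(* Joining [m] to every [m <| s], [s] in [S], turns [M] into a locally finite
   graph on which [G] acts by automorphisms, transitively.  Consequently every
   [c] moves points by a bounded distance, and conversely a map [f] of bounded
   displacement coincides piecewise with finitely many maps [_ <| c].

   (1) => (2): if no finite set is almost invariant, then balls of some radius
   [k] at least double the size of finite sets.  Hall's marriage theorem gives
   an injective [f : M * bool -> M] with [f (m, b)] within distance [k] of [m];
   an invariant measure gives mass 1 to each of the two disjoint images.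

   (3) => (1): take a limit along an ultrafilter of the densities of [A] in sets
   [F n] with small relative boundary.  A point [a] such that only one of [a],
   [a <| c] lies in [F n] is within a bounded distance of the boundary of [F n],
   so the densities of [A] and [A <| c] have the same limit. *)

(** * Hall's marriage theorem *)

Section Hall.
Variables X Y : choiceType.
Local Open Scope fset_scope.
Local Open Scope nat_scope.
Implicit Types (N : X -> {fset Y}) (F : {fset X}).

Definition fnbhd N F : {fset Y} := \bigcup_(x <- F) N x.

Lemma fnbhdP N F y : reflect (exists2 x, x \in F & y \in N x) (y \in fnbhd N F).
Proof.
apply: (iffP (bigfcupP _ _ _ _)) => [[x /andP[xF _] yN]|[x xF yN]].
  by exists x.
by exists x; rewrite ?xF.
Qed.

Lemma fnbhd_sub N F F' : F `<=` F' -> fnbhd N F `<=` fnbhd N F'.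
Proof.
move=> sFF'; apply/fsubsetP => y /fnbhdP[x xF yN].
by apply/fnbhdP; exists x => //; exact: (fsubsetP sFF').
Qed.

Lemma fnbhd_eq N N' F : {in F, N =1 N'} -> fnbhd N F = fnbhd N' F.
Proof.
move=> NN'; apply/fsetP => y.
by apply/fnbhdP/fnbhdP => -[x xF yN]; exists x => //; rewrite ?NN' // -NN'.
Qed.

Lemma card_fnbhd N F K :
  (forall x, x \in F -> #|` N x| <= K) -> #|` fnbhd N F| <= K * #|` F|.
Proof.
elim/finSet_rect: F => F IH cN.
have [->|[x xF]] := fset_0Vmem F.
  by rewrite /fnbhd big_seq_fset0 cardfs0.
have -> : fnbhd N F = N x `|` fnbhd N (F `\ x).
  apply/fsetP => y; rewrite inE; apply/fnbhdP/orP => [[z zF yN]|].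
    have [<-|zx] := eqVneq z x; [by left|right].
    by apply/fnbhdP; exists z; rewrite // !inE zx.
  case=> [yN|/fnbhdP[z]]; first by exists x.
  by rewrite !inE => /andP[_ zF] yN; exists z.
rewrite (cardfsD1 x F) xF mulnDr muln1.
apply: leq_trans (_ : #|` N x| + #|` fnbhd N (F `\ x)| <= _).
  by rewrite -cardfsUI leq_addr.
rewrite leq_add ?cN // IH ?fproperD1 // => z.
by rewrite !inE => /andP[_ zF]; exact: cN.
Qed.

Definition hall_condition N := forall F, #|` F| <= #|` fnbhd N F|.

(* Rado: if deleting either of [y1], [y2] from [N x] violates Hall's condition,
   submodularity of [F |-> #|fnbhd N F|] contradicts it for [x |` (A1 `|` A2)]
   and [A1 `&` A2], where [A1], [A2] are the violating sets without [x]. *)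
Lemma hall_shrink N x y1 y2 : hall_condition N ->
  y1 \in N x -> y2 \in N x -> y1 != y2 ->
  exists2 y, y \in N x & hall_condition (fun z => if z == x then N x `\ y else N z).
Proof.
move=> hN y1N y2N y12.
pose N' y z := if z == x then N x `\ y else N z.
suff [|] : hall_condition (N' y1) \/ hall_condition (N' y2).
  by exists y1.
  by exists y2.
apply: contrapT => /not_orP[/existsNP[F1 h1] /existsNP[F2 h2]].
move/negP: h1; move/negP: h2; rewrite -!ltnNge => h2 h1.
(* The family [N' y] agrees with [N] off [x], so a violating set must contain [x], and its
   neighbourhood splits accordingly. *)
have Fx y F : #|` fnbhd (N' y) F| < #|` F| ->
    (x \in F) /\ fnbhd (N' y) F = fnbhd N (F `\ x) `|` (N x `\ y).
  move=> hF; have xF : x \in F.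
    apply/negPn/negP => xF; move: hF; rewrite ltnNge => /negP; apply.
    rewrite (@fnbhd_eq _ N) // => z zF; rewrite /N' ifF //.
    by apply: contraNF xF => /eqP <-.
  split => //; apply/fsetP => z; rewrite inE.
  apply/fnbhdP/orP => [[w wF]|].
    rewrite /N'; case: eqVneq => [_|wx]; [by right|left].
    by apply/fnbhdP; exists w; rewrite // !inE wx.
  case=> [/fnbhdP[w]|zN]; last by exists x; rewrite // /N' eqxx.
  rewrite !inE => /andP[wx wF] zN; exists w => //.
  by rewrite /N' (negbTE wx).
have [x1 e1] := Fx _ _ h1; have [x2 e2] := Fx _ _ h2.
rewrite e1 (cardfsD1 x) x1 add1n ltnS in h1.
rewrite e2 (cardfsD1 x) x2 add1n ltnS in h2.
set A1 := F1 `\ x in e1 h1; set A2 := F2 `\ x in e2 h2.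
have xA : x \notin A1 `|` A2 by rewrite !inE eqxx.
clearbody A1 A2; clear Fx x1 x2 e1 e2.
have := hN (x |` (A1 `|` A2)); rewrite cardfsU1 xA.
have := hN (A1 `&` A2).
have := cardfsUI A1 A2.
have := cardfsUI (fnbhd N A1 `|` (N x `\ y1)) (fnbhd N A2 `|` (N x `\ y2)).
(* As [y1 != y2], the two deletions compensate each other: the union regains all of [N x]. *)
have -> : (fnbhd N A1 `|` (N x `\ y1)) `|` (fnbhd N A2 `|` (N x `\ y2)) =
          fnbhd N (x |` (A1 `|` A2)).
  apply/fsetP => z; rewrite !inE; apply/idP/fnbhdP.
    case/orP => /orP[/fnbhdP[w wA zN]|/andP[_ zN]].
    - by exists w => //; rewrite !inE wA orbT.
    - by exists x => //; rewrite !inE eqxx.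
    - by exists w => //; rewrite !inE wA !orbT.
    - by exists x => //; rewrite !inE eqxx.
  case=> w; rewrite !inE => /or3P[/eqP ->|wA|wA] zN.
  - rewrite zN !andbT; case: (eqVneq z y1) => [->|]; last by rewrite orbT.
    by rewrite y12 !orbT.
  - rewrite [X in X || _](_ : _ = true) //.
    by apply/orP; left; apply/fnbhdP; exists w.
  - rewrite orbC [X in X || _](_ : _ = true) //.
    by apply/orP; left; apply/fnbhdP; exists w.
have : fnbhd N (A1 `&` A2) `<=`
  (fnbhd N A1 `|` (N x `\ y1)) `&` (fnbhd N A2 `|` (N x `\ y2)).
  apply/fsubsetP => z /fnbhdP[w]; rewrite !inE => /andP[w1 w2] zN.
  by apply/andP; split; apply/orP; left; apply/fnbhdP; exists w; rewrite // !inE.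
move/fsubset_leq_card.
move: h1 h2.
set a := #|` fnbhd N A1 `|` _|; set b := #|` fnbhd N A2 `|` _|.
set c := #|` fnbhd N (A1 `&` A2)|; set d := #|` _ `&` _|.
rewrite -/d; set e := #|` _|; set f := #|` A1 `|` _|; set g := #|` A1 `&` A2|.
move=> h1 h2 h3 h4 h5 h6 h7.
(* The chain is [a + b <= f + g <= f + c < e + d = a + b]; strictness comes from counting [x]
   itself. *)
have : a + b < a + b.
  rewrite -{2}h4; apply: leq_trans (leq_add h7 h3).
  by rewrite add1n addSn ltnS (leq_trans (leq_add h1 h2)) // -h5 leq_add2l.
by rewrite ltnn.
Qed.

(* By Zorn's lemma there is a minimal subfamily of [N] satisfying Hall's
   condition; by [hall_shrink] its members are singletons. *)
Theorem hall_marriage N : hall_condition N ->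
  exists2 f : X -> Y, injective f & forall x, f x \in N x.
Proof.
move=> hN.
pose T := {n : X -> {fset Y} | hall_condition n /\ forall x, n x `<=` N x}.
pose t0 : T := exist _ N (conj hN (fun x => fsubset_refl _)).
(* Reverse inclusion: a maximal element for [R] is a minimal subfamily. *)
pose R (s t : T) := `[< forall x, sval t x `<=` sval s x >].
have [||A Atot|t tmax] := @ZL_preorder T t0 R.
- by move=> s; apply/asboolP => x.
- move=> r s t /asboolP rs /asboolP st; apply/asboolP => x.
  exact: fsubset_trans (st x) (rs x).
- have [->|/set0P[a Aa]] := eqVneq A set0.
    by exists t0.
  pose n x := [fset y in sval a x | `[< forall s, A s -> y \in sval s x >]].
  have nE x y : reflect (forall s, A s -> y \in sval s x) (y \in n x).
    rewrite !inE; apply: (iffP andP) => [[_ /asboolP]//|h].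
    by split; [exact: h|apply/asboolP].
  have n_sub s x : A s -> n x `<=` sval s x.
    by move=> As; apply/fsubsetP => y /nE; exact.
  (* Hall's condition concerns one finite [F] at a time, and on [F] the intersection [n] of the
     chain is attained by a member of least total size. *)
  suff n_eq F : exists2 s, A s & {in F, n =1 sval s}.
    have nP : hall_condition n /\ forall x, n x `<=` N x.
      split=> [F|x]; last exact: fsubset_trans (n_sub _ _ Aa) ((svalP a).2 x).
      by have [s As /fnbhd_eq ->] := n_eq F; exact: (svalP s).1.
    by exists (exist _ n nP) => s As; apply/asboolP => x; exact: n_sub.
  pose P k := `[< exists2 s, A s & \sum_(x <- F) #|` sval s x| = k >].
  have exP : exists k, P k by eexists; apply/asboolP; exists a.
  case: (ex_minnP exP) => k /asboolP[s As sk] kmin; exists s => // x xF.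
  apply/eqP; rewrite eqEfsubset n_sub //=; apply/fsubsetP => y ys; apply/nE => r Ar.
  have [/asboolP rs|/asboolP sr] := Atot _ _ Ar As; first exact: (fsubsetP (rs x)).
  have le_sr z : #|` sval r z| <= #|` sval s z| by exact: fsubset_leq_card (sr z).
  have := kmin _ (introT (asboolP _) (ex_intro2 _ _ r Ar erefl)).
  rewrite -sk => le.
  suff /eqP -> : sval r x == sval s x by [].
  rewrite eqEfcard sr leqNgt; apply/negP => lt.
  move: le; rewrite leqNgt => /negP; apply.
  rewrite (big_fsetD1 x xF) [X in _ < X](big_fsetD1 x xF) /= -addSn leq_add //.
  by apply: leq_sum.
have ex_y x : exists y, y \in sval t x.
  have := (svalP t).1 [fset x]; rewrite cardfs1 cardfs_gt0 => /fset0Pn[y].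
  by case/fnbhdP => z; rewrite !inE => /eqP ->; exists y.
have uniq_y x y1 y2 : y1 \in sval t x -> y2 \in sval t x -> y1 = y2.
  move=> y1t y2t; apply/eqP; apply: contrapT => /negP y12.
  have [y yt hn] := hall_shrink (svalP t).1 y1t y2t y12.
  set n := (fun z => _) in hn.
  have n_sub z : n z `<=` sval t z.
    by rewrite /n; case: eqP => [->|_] //; exact: fsubD1set.
  have nP : hall_condition n /\ forall x, n x `<=` N x.
    by split => // z; exact: fsubset_trans (n_sub z) ((svalP t).2 z).
  have /asboolP/(_ x)/fsubsetP/(_ y yt) : R (exist _ n nP) t.
    by apply: tmax; apply/asboolP.
  by rewrite /= /n eqxx !inE eqxx.
have [f fP] := choice ex_y.
exists f => [x1 x2 f12|x]; last exact: (fsubsetP ((svalP t).2 x)).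
apply/eqP; apply: contrapT => /negP x12.
(* Two points with the same singleton would have only one neighbour between them. *)
have := (svalP t).1 [fset x1; x2]; rewrite cardfs2 x12 ltnNge => /negP; apply.
rewrite -[leqRHS]/1 -(cardfs1 (f x1)); apply: fsubset_leq_card; apply/fsubsetP => y.
case/fnbhdP => z; rewrite !inE => /orP[]/eqP -> yt.
  by rewrite (uniq_y _ _ _ yt (fP x1)).
by rewrite f12 (uniq_y _ _ _ yt (fP x2)).
Qed.

End Hall.

(** * Expansion in locally finite graphs *)

Section Graph.
Variables (M : choiceType) (nb : M -> {fset M}) (K : nat).
Hypothesis nb_refl : forall x, x \in nb x.
Hypothesis nb_sym : forall x y, y \in nb x -> x \in nb y.
Hypothesis card_nb : forall x, (#|` nb x| <= K)%N.
Local Open Scope fset_scope.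

Definition nball k (F : {fset M}) : {fset M} := iter k (fnbhd nb) F.

(** For the graph of a cell space this is the set in the numerator of the isoperimetric quotient,
    see [inner_boundaryE]. *)
Definition inner_boundary (F : {fset M}) : {fset M} :=
  [fset x in F | ~~ (nb x `<=` F)].

Lemma nballSr k F : nball k.+1 F = nball k (fnbhd nb F).
Proof. exact: iterSr. Qed.

Lemma nballE k F : nball k F = fnbhd (fun x => nball k [fset x]) F.
Proof.
elim: k => [|k IH].
  apply/fsetP => x; apply/idP/fnbhdP => [xF|[y yF]]; first by exists x; rewrite ?inE.
  by rewrite !inE => /eqP ->.
rewrite [LHS]/= IH; apply/fsetP => x; apply/fnbhdP/fnbhdP.
  case=> y /fnbhdP[z zF yz] xy; exists z => //.
  by apply/fnbhdP; exists y.
by case=> y yF /fnbhdP[z zy xz]; exists z => //; apply/fnbhdP; exists y.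
Qed.

Lemma nball_sub k F F' : F `<=` F' -> nball k F `<=` nball k F'.
Proof. by rewrite (nballE k F) (nballE k F'); exact: fnbhd_sub. Qed.

Lemma mem_nballS k x y z : y \in nb x -> z \in nball k [fset y] ->
  z \in nball k.+1 [fset x].
Proof.
move=> yx zy; rewrite nballSr nballE; apply/fnbhdP; exists y => //.
by apply/fnbhdP; exists x; rewrite ?inE.
Qed.

Lemma nball_refl k x : x \in nball k [fset x].
Proof. by elim: k => [|k IH]; [rewrite inE | exact: mem_nballS IH]. Qed.

Lemma nball_sym k x y : y \in nball k [fset x] -> x \in nball k [fset y].
Proof.
elim: k x y => [|k IH] x y; first by rewrite !inE eq_sym.
by case/fnbhdP => z /IH xz /nb_sym; move: xz => /[swap]; exact: mem_nballS.
Qed.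

Lemma nball_leS k F : nball k F `<=` nball k.+1 F.
Proof. by apply/fsubsetP => x xk; apply/fnbhdP; exists x. Qed.

Lemma card_nball k F : (#|` nball k F| <= K ^ k * #|` F|)%N.
Proof.
elim: k => [|k IH]; first by rewrite mul1n.
apply: leq_trans (card_fnbhd (K := K) _) _ => [x _|]; first exact: card_nb.
by rewrite expnS -mulnA leq_mul2l IH orbT.
Qed.

(** Follow a path from [a] to [b]: either [a] is already in the inner boundary, or the first step
    stays in [F] and induction applies from there. *)
Lemma nball_exit k F a b : a \in F -> b \notin F -> b \in nball k [fset a] ->
  a \in nball k (inner_boundary F) /\ b \in nball k (inner_boundary F).
Proof.
elim: k a => [|k IH] a aF bF; first by rewrite inE => /eqP ba; rewrite ba aF in bF.
have [/fsubsetP nbF|nbF] := boolP (nb a `<=` F).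
  rewrite nballSr nballE => /fnbhdP[c /fnbhdP[a']]; rewrite inE => /eqP -> ca bc.
  have [cB bB] := IH c (nbF _ ca) bF bc.
  split; last exact: (fsubsetP (nball_leS _ _)).
  by apply/fnbhdP; exists c => //; exact: nb_sym.
have /(nball_sub k.+1)/fsubsetP sB : [fset a] `<=` inner_boundary F.
  by rewrite fsub1set !inE aF.
by move=> bk; split; apply: sB => //; exact: nball_refl.
Qed.

Lemma nball_cross k F a b : b \in nball k [fset a] -> (a \in F) != (b \in F) ->
  a \in nball k (inner_boundary F).
Proof.
move=> bk; have [aF|aF] := boolP (a \in F); have [bF|bF] := boolP (b \in F) => // _.
  exact: (nball_exit aF bF bk).1.
exact: (nball_exit bF aF (nball_sym bk)).2.
Qed.

(** Every inner boundary point is a neighbour of a point of the outer boundary, and such a point has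
    at most [K] neighbours. *)
Lemma card_inner_boundary F : (#|` inner_boundary F| <= K * #|` fnbhd nb F `\` F|)%N.
Proof.
have card_nb' x : x \in fnbhd nb F `\` F -> (#|` nb x| <= K)%N by [].
apply: leq_trans (card_fnbhd card_nb').
apply/fsubset_leq_card/fsubsetP => x; rewrite !inE => /andP[xF /fsubsetPn[y yx yF]].
apply/fnbhdP; exists y; last exact: nb_sym.
by rewrite inE yF; apply/fnbhdP; exists x.
Qed.

(** A large inner boundary forces a large outer one, so each step outwards multiplies the size by at
    least [1 + d]. *)
Lemma nball_expanding (R : realType) (eps : R) : 0 < eps ->
    (forall F : {fset M}, F != fset0 ->
      eps * #|` F|%:R <= #|` inner_boundary F|%:R) ->
  exists k, forall F, (2 * #|` F| <= #|` nball k F|)%N.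
Proof.
move=> eps0 expF; have K0 : (0 < K.+1%:R :> R) by rewrite ltr0n.
pose d := eps / K.+1%:R; have d0 : 0 < d by rewrite divr_gt0.
have step (F : {fset M}) : (1 + d) * #|` F|%:R <= #|` fnbhd nb F|%:R.
  have [->|F0] := eqVneq F fset0; first by rewrite cardfs0 mulr0 ler0n.
  have sF : F `<=` fnbhd nb F by apply/fsubsetP => x xF; apply/fnbhdP; exists x.
  rewrite -(cardfsID F (fnbhd nb F)) (fsetIidPr sF) natrD mulrDl mul1r lerD2l.
  rewrite /d mulrAC ler_pdivrMr // (le_trans (expF _ F0)) // -natrM ler_nat.
  by rewrite (leq_trans (card_inner_boundary F)) // mulnC leq_mul2l leqnSn orbT.
clearbody d.
(* With [k >= 1/d], Bernoulli's inequality gives [(1 + d) ^+ k >= 1 + k * d >= 2]. *)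
have [k kd] : exists k : nat, d^-1 <= k%:R.
  by exists (Num.truncn d^-1).+1; exact/ltW/truncnS_gt.
have bern (n : nat) : (1 + n%:R * d <= (1 + d) ^+ n)%R.
  elim: n => [|n IH]; first by rewrite mul0r addr0 expr0.
  have d1 : 0 <= (1 + d)%R by rewrite addr_ge0 // ltW.
  rewrite exprS (le_trans _ (ler_wpM2l d1 IH)) //.
  have : 0 <= n%:R * d * d by rewrite !mulr_ge0 ?ler0n ?(ltW d0).
  by rewrite -natr1; nra.
exists k => F; rewrite -(ler_nat R) natrM.
have iterk (n : nat) : (1 + d) ^+ n * #|` F|%:R <= #|` nball n F|%:R.
  elim: n => [|n IH]; first by rewrite expr0 mul1r.
  by rewrite exprS -mulrA (le_trans _ (step _)) // ler_wpM2l // addr_ge0 ?(ltW d0).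
rewrite (le_trans _ (iterk k)) // ler_wpM2r ?ler0n // (le_trans _ (bern k)) //.
by rewrite -[2%:R]/(1 + 1)%R lerD2l -ler_pdivrMr // mul1r.
Qed.

Lemma nball_doubling (R : realType) (eps : R) : 0 < eps ->
    (forall F : {fset M}, F != fset0 ->
      eps * #|` F|%:R <= #|` inner_boundary F|%:R) ->
  exists k, exists2 f : M * bool -> M, injective f &
    forall x, f x \in nball k [fset x.1].
Proof.
move=> eps0 /(nball_expanding eps0)[k dbl]; exists k.
apply: hall_marriage => F.
have -> : fnbhd (fun x => nball k [fset x.1]) F = nball k (fst @` F).
  rewrite (nballE k (_ @` _)); apply/fsetP => y; apply/fnbhdP/fnbhdP.
    by case=> x xF yx; exists x.1 => //; apply/imfsetP; exists x.
  by case=> _ /imfsetP[x /= xF ->] yx; exists x.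
apply: leq_trans (dbl _).
(* [F] has at most two points over each element of its projection to [M], so doubling yields Hall's
   condition. *)
have c2 x : x \in fst @` F -> (#|` [fset (x, true); (x, false)]| <= 2)%N.
  by rewrite cardfs2; case: eqP.
apply: leq_trans (card_fnbhd c2).
apply/fsubset_leq_card/fsubsetP => -[x b] xF; apply/fnbhdP.
exists x; first by apply/imfsetP; exists (x, b).
by rewrite !inE; case: b {xF}; rewrite eqxx ?orbT.
Qed.

End Graph.

(** * The graph of a cell space *)

Section CellSpaceGraph.
Variables (G : groupType) (M : choiceType) (C : cellSpace G M).
Variable S : set (set G).
Hypothesis finS : finite_set S.
Hypothesis genS : right_generating C S.
Hypothesis symS : symmetric_cosets C S.

Lemma cactM g h m : cact C (g * h)%g m = cact C g (cact C h m).
Proof. exact: lactM. Qed.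

Lemma cact1 m : cact C 1%g m = m.
Proof. exact: lact1. Qed.

Lemma cgK m : cact C (cg C m) (m0 C) = m.
Proof. exact: coordK. Qed.

Lemma cactK g : cancel (cact C g) (cact C g^-1%g).
Proof. by move=> m; rewrite -cactM mulVg cact1. Qed.

Lemma ltransM g h (A : set G) : ltrans (g * h)%g A = ltrans g (ltrans h A).
Proof.
apply/seteqP; split=> [_ [a Aa <-]|_ [_ [a Aa <-] <-]].
  by exists (h * a)%g; rewrite ?mulgA//; exists a.
by exists a; rewrite // mulgA.
Qed.

(** Identifies cosets with points of [M]: the maps [_ <| c] are the maps sending [m] to [cg m]
    applied to a fixed [p]. *)
Lemma semiact_coset m p : semiact C m (ltrans (cg C p) (stab C)) = cact C (cg C m) p.
Proof. by rewrite semiactE cactM cgK. Qed.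

Lemma semiactP c : exists p, forall m, semiact C m c = cact C (cg C m) p.
Proof. by exists (cact C (xget 1%g c) (m0 C)) => m; rewrite -cactM. Qed.

(** Including [m] makes balls of growing radius nested. *)
Definition cell_nb (m : M) : {fset M} := (m |` fset_set (semiact C m @` S))%fset.

Lemma cell_nbP x y : reflect (y = x \/ exists2 s, S s & y = semiact C x s)
  (y \in cell_nb x).
Proof.
rewrite /cell_nb in_fset1U in_fset_set; last exact: finite_image.
apply: (iffP orP) => -[].
- by move/eqP; left.
- by rewrite inE => -[s Ss <-]; right; exists s.
- by move=> ->; left.
- by case=> s Ss ->; right; rewrite inE; exists s.
Qed.

Lemma cell_nb_refl x : x \in cell_nb x.
Proof. by apply/cell_nbP; left. Qed.

Lemma card_cell_nb x : (#|` cell_nb x| <= #|` fset_set S|.+1)%N.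
Proof.
rewrite /cell_nb cardfsU1 -add1n leq_add ?leq_b1 // fset_set_image //.
exact: leq_imfset_card.
Qed.

Lemma cell_nb_sym x y : y \in cell_nb x -> x \in cell_nb y.
Proof.
case/cell_nbP => [->|[s Ss ->]]; first exact: cell_nb_refl.
have [sG _ _] := genS; have [h _ eh] := sG _ Ss; rewrite -eh semiactE.
set z := cact _ _ _; apply/cell_nbP; right.
(* As [t] fixes the origin, [h * t^-1] is another representative of [s]; the coset of its inverse
   leads from [z] back to [x]. *)
pose t := ((cg C z)^-1 * (cg C x * h))%g.
have tz : cact C t (m0 C) = m0 C by rewrite /t cactM -/z -{2}[z]cgK cactK.
exists (ltrans (h * t^-1)^-1%g (stab C)).
  apply: symS; exists s, (h * t^-1)%g; split => //.
  by rewrite -eh; exists t^-1%g => //=; rewrite /stab /= -{1}tz cactK.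
by rewrite semiactE invgM invgK /t !mulgA mulgV mul1g mulgK cgK.
Qed.

(** Moving [x <| s] by [g] gives [(g x) <| t s] with [t] in the stabiliser, and [S] is closed under
    left multiplication by such [t]. *)
Lemma cell_nb_act g x y : y \in cell_nb x -> cact C g y \in cell_nb (cact C g x).
Proof.
case/cell_nbP => [->|[s Ss ->]]; first exact: cell_nb_refl.
have [sG G0S _] := genS; have [h _ eh] := sG _ Ss; rewrite -eh semiactE -cactM.
apply/cell_nbP; right; set z := cact C g x.
pose t := ((cg C z)^-1 * (g * cg C x))%g.
have tz : cact C t (m0 C) = m0 C by rewrite /t !cactM cgK -/z -{2}[z]cgK cactK.
exists (ltrans t s); first exact: G0S.
by rewrite -eh -ltransM semiactE /t !mulgA mulgV mul1g.
Qed.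

Lemma nball_act k g x y :
  y \in nball cell_nb k [fset x]%fset ->
  cact C g y \in nball cell_nb k [fset cact C g x]%fset.
Proof.
elim: k y => [|k IH] y; first by rewrite !inE => /eqP ->.
by case/fnbhdP => z /IH zx /(cell_nb_act g) yz; apply/fnbhdP; exists (cact C g z).
Qed.

(** The automorphism [cg m] carries the pair of the origin and [p] to the pair of [m] and [m <| c];
    the first pair is at finite distance because [S] generates. *)
Lemma nball_semiact c : exists k, forall m,
  semiact C m c \in nball cell_nb k [fset m]%fset.
Proof.
have [p cE] := semiactP c.
suff [k pk] : exists k, p \in nball cell_nb k [fset m0 C]%fset.
  by exists k => m; rewrite cE -{2}[m]cgK; exact: nball_act.
have [_ _ /(_ p)[w [wS <-]]] := genS.
elim/last_ind: w wS => [|w s IH] wS.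
  by exists 0; exact: nball_refl cell_nb_refl _ _.
have [t tw|k kw] := IH; first by apply: wS; rewrite mem_rcons inE tw orbT.
exists k.+1; rewrite foldl_rcons; apply/fnbhdP; eexists; first exact: kw.
apply/cell_nbP; right; exists s => //.
by case: (wS s); rewrite ?mem_rcons ?mem_head//; exact: symS.
Qed.

(** The ball about the origin is finite, so only finitely many [p] occur for a map of displacement
    at most [k]. *)
Lemma mem_nball_semiact k m x : x \in nball cell_nb k [fset m]%fset ->
  exists2 p, p \in nball cell_nb k [fset m0 C]%fset & x = cact C (cg C m) p.
Proof.
move=> xm; exists (cact C (cg C m)^-1%g x); last by rewrite -cactM mulgV cact1.
by rewrite -[m0 C](cactK (cg C m)) cgK; exact: nball_act.
Qed.

Lemma inner_boundaryE (A : {fset M}) :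
  [set` inner_boundary cell_nb A] =
  \bigcup_(e in S) ([set` A] `\` (semiact C ^~ e) @^-1` [set` A]).
Proof.
apply/seteqP; split => [x /=|x [e Se [/= xA exA]]].
  rewrite !inE => /andP[xA /fsubsetPn[y /cell_nbP[->|[s Ss ->]] yA]].
    by rewrite xA in yA.
  by exists s => //; split => //; apply/negP.
rewrite !inE /= xA; apply/fsubsetPn; exists (semiact C x e); last exact/negP.
by apply/cell_nbP; right; exists e.
Qed.

Lemma card_inner_boundary_le (A : {fset M}) K :
    (forall s, S s ->
      #|` fset_set ([set` A] `\` (semiact C ^~ s) @^-1` [set` A])| <= K)%N ->
  (#|` inner_boundary cell_nb A| <= K * #|` fset_set S|)%N.
Proof.
move=> AK; pose E s := fset_set ([set` A] `\` (semiact C ^~ s) @^-1` [set` A]).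
have EK s : s \in fset_set S -> (#|` E s| <= K)%N.
  by rewrite in_fset_set // => /set_mem; exact: AK.
apply: leq_trans (card_fnbhd EK); apply/fsubset_leq_card/fsubsetP => x.
have /seteqP[+ _] := inner_boundaryE A => /(_ x)/[apply] -[s Ss xs].
apply/fnbhdP; exists s; rewrite ?in_fset_set ?mem_set //.
by apply: finite_setD; exact: finite_fset.
Qed.

End CellSpaceGraph.

(** * Amenability *)

Section Amenable.
Variables (R : realType) (G : groupType) (M : choiceType) (C : cellSpace G M).

(** Induction on [T]: split off the piece [B1] on which [f] is the map given by [p]. Injectivity of
    [f] makes invariance applicable there and keeps the images of the pieces disjoint. *)
Lemma invariant_piecewise (mu : set M -> R) (f : M -> M) (T : seq M) (B : set M) :
    finitely_additive_probability mu ->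
    (forall (c : set G) (A : set M), lcosets C c -> set_inj A (semiact C ^~ c) ->
      mu ((semiact C ^~ c) @` A) = mu A) ->
    injective f ->
    (forall m, B m -> exists2 p, p \in T & f m = cact C (cg C m) p) ->
  mu (f @` B) = mu B.
Proof.
move=> mu_prob mu_inv f_inj; elim: T B => [|p T IH] B fT.
  suff -> : B = set0 by rewrite image_set0.
  by rewrite -subset0 => m /fT[].
have [_ _ muD] := mu_prob.
pose B1 := B `&` [set m | f m = cact C (cg C m) p]; pose B2 := B `\` B1.
have B12 : B1 `&` B2 = set0 by rewrite /B2 setDE setICA setICr setI0.
have BE : B = B1 `|` B2 by rewrite setDUK // => x [].
have fB1 : f @` B1 = (semiact C ^~ (ltrans (cg C p) (stab C))) @` B1.
  by apply: eq_imagel => m [_ ->]; rewrite semiact_coset.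
have injB1 : set_inj B1 (semiact C ^~ (ltrans (cg C p) (stab C))).
  move=> x y /set_mem[_ fx] /set_mem[_ fy]; rewrite !semiact_coset -fx -fy.
  exact: f_inj.
rewrite [in RHS]BE [in LHS]BE image_setU !muD //; last first.
  rewrite -subset0 => _ [[x B1x <-] [y B2y /f_inj yx]].
  by have : (B1 `&` B2) x; [rewrite yx in B2y|rewrite B12].
congr (_ + _).
  by rewrite fB1 mu_inv //; exists (cg C p).
apply: IH => m [Bm nB1]; have [q] := fT m Bm.
rewrite inE => /orP[/eqP ->|qT] fm; last by exists q.
by case: nB1; split.
Qed.

Variable S : set (set G).
Hypothesis finS : finite_set S.
Hypothesis genS : right_generating C S.
Hypothesis symS : symmetric_cosets C S.
Local Notation nb := (cell_nb C S).

Lemma right_amenable_folner (eps : R) : right_amenable C R -> 0 < eps ->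
  exists2 A : {fset M}, A != fset0 & #|` inner_boundary nb A|%:R < eps * #|` A|%:R.
Proof.
move=> [mu [mu_prob mu_inv]] eps0.
apply: contrapT => nF.
have [|k [f f_inj fk]] := nball_doubling (cell_nb_refl C finS)
    (cell_nb_sym finS genS symS) (card_cell_nb C finS) eps0.
  by move=> A A0; rewrite leNgt; apply/negP => lt; apply: nF; exists A.
have [mu_ge0 muT muD] := mu_prob.
(* For fixed [b] the map is injective with displacement at most [k], so the image has the mass of
   [M]. *)
have half b : mu (range (fun m => f (m, b))) = 1.
  rewrite (@invariant_piecewise mu _ (nball nb k [fset m0 C]%fset)) // => [x y|m _].
    by move/f_inj => [].
  exact: mem_nball_semiact (fk (m, b)).
set A := range (fun m => f (m, true)); set B := range (fun m => f (m, false)).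
have AB : A `&` B = set0 by rewrite -subset0 => _ [[x _ <-] [y _ /f_inj]].
have := muD _ _ (setICr (A `|` B)); rewrite setUv muT (muD _ _ AB) !half.
have := mu_ge0 (~` (A `|` B)); lra.
Qed.

End Amenable.

(** * Limits of densities along an ultrafilter *)

Section Density.
Variables (R : realType) (M : choiceType).

Definition density (F : {fset M}) (A : set M) : R :=
  #|` [fset x in F | x \in A]%fset|%:R / #|` F|%:R.

Lemma density_ge0 F A : 0 <= density F A.
Proof. by rewrite divr_ge0 ?ler0n. Qed.

Lemma density_le1 F A : density F A <= 1.
Proof.
have [->|F0] := eqVneq F fset0; first by rewrite /density cardfs0 invr0 mulr0.
rewrite ler_pdivrMr ?ltr0n ?cardfs_gt0 // mul1r ler_nat.
by apply/fsubset_leq_card/fsubsetP => x; rewrite !inE => /andP[].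
Qed.

Lemma densityT F : F != fset0 -> density F setT = 1.
Proof.
move=> F0; rewrite /density (_ : [fset _ in _ | _]%fset = F).
  by rewrite divff // pnatr_eq0 cardfs_eq0.
by apply/fsetP => x; rewrite !inE in_setT andbT.
Qed.

Lemma densityU F A B : A `&` B = set0 ->
  density F (A `|` B) = density F A + density F B.
Proof.
move=> AB; rewrite /density -mulrDl -natrD -cardfsUI.
have -> : ([fset x in F | x \in A] `&` [fset x in F | x \in B])%fset = fset0.
  apply/fsetP => x; rewrite !inE; apply/negP.
  move=> /andP[/andP[_ /set_mem Ax] /andP[_ /set_mem Bx]].
  by have : (A `&` B) x by []; rewrite AB.
rewrite cardfs0 addn0; congr (_%:R / _).
apply: (congr1 (fun A : {fset M} => #|` A|)).
by apply/fsetP => x; rewrite !inE in_setU andb_orr.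
Qed.

Lemma fmap_ultra (T T' : Type) (f : T -> T') (U : set_system T) :
  UltraFilter U -> UltraFilter (f @ U).
Proof.
move=> UU; split=> [|H HF sUH]; first exact: fmap_proper_filter.
apply/seteqP; split=> // A HA.
have [//|/(sUH (~` A)) HnA] := in_ultra_setVsetC (f @^-1` A) UU.
by have [x []] := filter_ex (filterI HA HnA).
Qed.

(** Compactness of the segment: an ultrafilter containing it converges. *)
Lemma ultra_bounded_cvg (U : set_system nat) (u : nat -> R) (a b : R) :
  UltraFilter U -> (forall n, a <= u n <= b) -> cvg (u @ U).
Proof.
move=> UU uab; have := @segment_compact R a b; rewrite compact_ultra.
move=> /(_ (u @ U) (fmap_ultra _ UU))[|l [_ ul]].
  change (U (u @^-1` `[a, b])); apply: filterE => n; rewrite /= in_itv /=; exact: uab.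
by apply/cvg_ex; exists l.
Qed.

Lemma asymptotic_density (F : nat -> {fset M}) : (forall n, F n != fset0) ->
  exists2 mu : set M -> R, finitely_additive_probability mu &
    forall A B, density (F n) A - density (F n) B @[n --> \oo] --> (0 : R) ->
      mu A = mu B.
Proof.
move=> F0; have [U [UU ooU]] := @ultraFilterLemma nat \oo _.
have d_cvg A : cvg (density (F n) A @[n --> U]).
  by apply: (@ultra_bounded_cvg _ _ 0 1) => n; rewrite density_ge0 density_le1.
exists (fun A => lim (density (F n) A @[n --> U])).
  split=> [A||A B AB].
  - apply: limr_ge => //; by apply: nearW => n; exact: density_ge0.
  - rewrite (_ : (fun n => _) = cst 1); first exact: lim_cst.
    by apply/funext => n; exact: densityT.
  - rewrite -limD //; congr (lim (_ @ U)); apply/funext => n; exact: densityU.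
move=> A B AB; apply/eqP; rewrite -subr_eq0 -limB //; apply/eqP.
(* [U] refines [\oo], so a sequence tending to 0 at infinity also does so along [U]. *)
by apply: cvg_lim => //; apply: cvg_trans AB; exact: cvg_app.
Qed.

End Density.

(** * From almost invariant finite sets to an invariant measure *)

Section Folner.
Variables (R : realType) (G : groupType) (M : choiceType) (C : cellSpace G M).
Variable S : set (set G).
Hypothesis finS : finite_set S.
Hypothesis genS : right_generating C S.
Hypothesis symS : symmetric_cosets C S.
Local Notation nb := (cell_nb C S).

(** Points whose membership in [F] changes under [_ <| c] lie in [D]. Hence the map embeds [X] minus
    [D] into [Y], and [Y] lies in the image of the union of [X] and [D]. *)
Lemma density_semiact k c (F : {fset M}) (A : set M) :
    (forall m, semiact C m c \in nball nb k [fset m]%fset) ->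
    set_inj A (semiact C ^~ c) ->
  `|density R F A - density R F ((semiact C ^~ c) @` A)| <=
    #|` nball nb k (inner_boundary nb F)|%:R / #|` F|%:R.
Proof.
move=> ck injA; set B := _ @` A; set D := nball _ _ _.
have cross a : (a \in F) != (semiact C a c \in F) -> a \in D.
  exact: (nball_cross (cell_nb_refl C finS) (cell_nb_sym finS genS symS) (ck a)).
set X := [fset x in F | x \in A]%fset; set Y := [fset x in F | x \in B]%fset.
have leX : (#|` X| <= #|` Y| + #|` D|)%N.
  rewrite -(cardfsID D X) addnC leq_add //; last exact/fsubset_leq_card/fsubsetIr.
  have <- : #|` (semiact C ^~ c @` (X `\` D))%fset| = #|` (X `\` D)%fset|.
    rewrite card_in_imfset //= => x y; rewrite !inE => /and3P[_ _ xA] /and3P[_ _].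
    exact: injA.
  apply/fsubset_leq_card/fsubsetP => _ /imfsetP[x /= + ->]; rewrite !inE.
  move=> /and3P[xD xF xA]; apply/andP; split; last first.
    by apply/mem_set; exists x => //; exact: set_mem.
  by apply: contraNT xD => cxF; apply: cross; rewrite xF (negbTE cxF).
have leY : (#|` Y| <= #|` X| + #|` D|)%N.
  rewrite -cardfsUI; apply: leq_trans (leq_addr _ _).
  have : (#|` (semiact C ^~ c @` (X `|` D))%fset| <= #|` (X `|` D)%fset|)%N.
    exact: leq_imfset_card.
  apply: leq_trans.
  apply/fsubset_leq_card/fsubsetP => y; rewrite !inE => /andP[+ /set_mem[a aA ay]].
  rewrite -ay => cF; apply/imfsetP; exists a => //=; rewrite !inE.
  have [aF|aF] := boolP (a \in F); first by rewrite mem_set.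
  by rewrite cross // cF (negbTE aF).
rewrite /density -mulrBl normrM [X in _ * X]ger0_norm ?invr_ge0 ?ler0n //.
rewrite ler_wpM2r ?invr_ge0 ?ler0n // ler_norml -/X -/Y.
move: leX leY; rewrite -!(ler_nat R) !natrD; lra.
Qed.

Lemma folner_right_amenable :
    (forall eps : R, 0 < eps -> exists2 A : {fset M}, A != fset0 &
       #|` inner_boundary nb A|%:R < eps * #|` A|%:R) ->
  right_amenable C R.
Proof.
move=> folner.
have /choice[F FP] (n : nat) : exists A : {fset M}, A != fset0 /\
    #|` inner_boundary nb A|%:R < n.+1%:R^-1 * #|` A|%:R :> R.
  by have [|A A0 bA] := folner n.+1%:R^-1; [rewrite invr_gt0 ltr0n|exists A].
have F0 n : F n != fset0 by have [] := FP n.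
have [mu mu_prob mu_lim] := asymptotic_density R F0.
exists mu; split => // c A _ injA; apply/esym/mu_lim.
have [k ck] := nball_semiact finS genS symS c.
(* A [k]-ball about a finite set is at most [K] times as large, so the density gap at [n] is at most
   [K / (n + 1)]. *)
set K := (#|` fset_set S|.+1 ^ k)%N.
apply: norm_cvg0; apply: (@squeeze_cvgr _ _ _ _ (cst 0)
  (fun n => K%:R * harmonic n)).
- apply: nearW => n; rewrite normr_ge0 /= (le_trans (density_semiact _ ck injA)) //.
  have Fn0 : 0 < #|` F n|%:R :> R by rewrite ltr0n cardfs_gt0.
  rewrite ler_pdivrMr // (@le_trans _ _ (K * #|` inner_boundary nb (F n)|)%:R) //.
    by rewrite ler_nat; exact: card_nball (card_cell_nb C finS) _ _.
  by rewrite natrM -mulrA ler_wpM2l ?ler0n // ltW //; have [] := FP n.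
- exact: cvg_cst.
- by rewrite -[0 in X in _ --> X](mulr0 K%:R); apply: cvgMl_tmp; exact: cvg_harmonic.
Qed.

End Folner.

(** * The cycle of implications, read through inner boundaries *)

Theorem theorem10p5 (R : realType) (G : groupType) (M : choiceType)
    (C : cellSpace G M) (S : set (set G)) :
  finitely_right_generated C ->
  finite_set (stab C) ->
  finite_set S ->
  right_generating C S ->
  symmetric_cosets C S ->
  [<-> right_amenable C R;
       forall eps : R, 0 < eps ->
         exists F : set M, [/\ F !=set0, finite_set F &
           forall s, S s ->
             cardR R (F `\` ((semiact C)^~ s) @^-1` F) / cardR R F < eps];
       isoperimetric_constant C R S = 0].
Proof.
move=> _ _ finS genS symS.
have card_gt0 (A : {fset M}) : A != fset0 -> 0 < #|` A|%:R :> R.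
  by rewrite ltr0n cardfs_gt0.
have cardE (A : {fset M}) : cardR R [set` A] = #|` A|%:R.
  by rewrite /cardR set_fsetK.
tfae.
- move=> amen eps eps0.
  have [A A0 bA] := right_amenable_folner finS genS symS amen eps0.
  exists [set` A]; split=> [|//|s Ss].
    by have /fset0Pn[x xA] := A0; exists x.
  (* The set for a single [s] is contained in the inner boundary. *)
  rewrite cardE ltr_pdivrMr ?card_gt0 //; apply: le_lt_trans bA.
  rewrite -cardE inner_boundaryE // ler_nat; apply/fsubset_leq_card.
  rewrite -fset_set_sub; first by move=> x ?; exists s.
  - by apply: finite_setD; exact: finite_fset.
  - by rewrite -inner_boundaryE //; exact: finite_fset.
- move=> folner; have iso_inf := has_inf_isoperimetric C R S.
  apply/eqP; rewrite eq_le; apply/andP; split; last first.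
    by apply: lb_le_inf; [exact: iso_inf.1|move=> _ [F _ <-];
      rewrite divr_ge0 ?ler0n].
  apply/ler_addgt0Pr => eps eps0; rewrite add0r.
  (* The sets for the elements of [S] together cost at most [#|S| * d <= eps]; the successor keeps
     the denominator nonzero for empty [S]. *)
  pose d := eps / #|` fset_set S|.+1%:R.
  have d0 : 0 < d by rewrite divr_gt0 ?ltr0n.
  have [F [F0 finF Fs]] := folner _ d0.
  apply: (@le_trans _ _ (cardR R (\bigcup_(e in S) (F `\` (semiact C ^~ e) @^-1` F))
      / cardR R F)); first by apply: ge_inf iso_inf.2 _ _; exists F.
  have FE : F = [set` fset_set F] by rewrite fset_setK.
  move: F0 Fs; rewrite FE -inner_boundaryE // => -[x /= xF] Fs.
  have Fn0 : fset_set F != fset0 by apply/fset0Pn; exists x.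
  have dF : 0 <= d * #|` fset_set F|%:R by rewrite mulr_ge0 ?ler0n ?ltW.
  rewrite !cardE ler_pdivrMr ?card_gt0 //.
  (* The union bound is stated for natural numbers, so the real bound is truncated. *)
  pose K := Num.truncn (d * #|` fset_set F|%:R).
  apply: (@le_trans _ _ (K * #|` fset_set S|)%:R).
    rewrite ler_nat; apply: card_inner_boundary_le => // s /Fs.
    by rewrite cardE ltr_pdivrMr ?card_gt0 // truncn_ge_nat //; exact: ltW.
  rewrite natrM; apply: (@le_trans _ _ (d * #|` fset_set F|%:R *
    #|` fset_set S|.+1%:R)).
    by rewrite ler_pM ?ler0n ?ler_nat // truncn_le.
  by rewrite mulrAC divfK ?pnatr_eq0.
- move=> iso0; apply: (folner_right_amenable finS genS symS) => eps eps0.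
  (* An infimum equal to 0 yields sets with quotient below any [eps], that is, with small inner
     boundary. *)
  have := inf_adherent eps0 (has_inf_isoperimetric C R S).
  rewrite -/(isoperimetric_constant C R S) iso0 add0r.
  move=> [_ [F [finF [x Fx]] <-]].
  have FE : F = [set` fset_set F] by rewrite fset_setK.
  have Fn0 : fset_set F != fset0.
    by apply/fset0Pn; exists x; rewrite in_fset_set // mem_set.
  rewrite FE -(inner_boundaryE C finS) !cardE => lt; exists (fset_set F) => //.
  by rewrite -ltr_pdivrMr ?card_gt0.
Qed.
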